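(* Let $n\ge 2$ be an integer and $G=\mathfrak S_{n+1}$. The Solomon zeta function of the Specht lattice $L^{(2,1^{n-1})}$ is given by $$\zeta_{\mathbf{Z}G}(L^{(2,1^{n-1})},s) = \zeta_{\mathbf{Q}}(ns)\prod_{p\mid n+1}\varphi_p(p^{-s}),\qquad \varphi_p = \frac{X^{v_p(n+1)+1}-1}{X-1},$$ where $p$ runs over all prime divisors of $n+1$ and $\zeta_{\mathbf{Q}}$ is the Riemann zeta function.
   Context: For the partition $\lambda=(2,1^{n-1})$ of $n+1$, the Specht module $V=S^\lambda$ over $\mathbf{Q}$ has the Specht basis $(e_T)_T$ indexed by the standard Young tableaux $T$ of shape $\lambda$; here $e_T=\sum_{\pi\in C_T}\operatorname{sgn}(\pi)\,\pi\{T\}$ is the polytabloid of $T$, with $\{T\}$ the tabloid (row equivalence class) of $T$ and $C_T$ the column stabilizer of $T$. The representation matrices with respect to this basis are integral, and the Specht lattice is the $\mathbf{Z}G$-lattice $L^\lambda=\bigoplus_T \mathbf{Z}e_T$. For a $\mathbf{Z}G$-lattice $M$ the Solomon zeta function is $\zeta_{\mathbf{Z}G}(M,s)=\sum_{N}|M:N|^{-s}$, where $N$ runs over all $\mathbf{Z}G$-sublattices $N\subseteq M$ of finite index; identities are identities of Dirichlet series in $s$ (equivalently, of functions for $\operatorname{Re}(s)$ sufficiently large). $v_p$ denotes the $p$-adic valuation. *)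

(* Defs.v *)
From HB Require Import structures.
From mathcomp Require Import all_boot all_order all_algebra fingroup perm.
From mathcomp Require Import complex.
From mathcomp Require Import finmap all_classical all_reals all_analysis.
From mathcomp Require Import summability.

Set Implicit Arguments.
Unset Strict Implicit.
Unset Printing Implicit Defensive.

Import Order.TTheory GRing.Theory Num.Theory numFieldNormedType.Exports.

Local Open Scope ring_scope.
Local Open Scope complex_scope.

(* Tableaux have entries in 'I_N, i.e. 0, ..., N-1 instead of 1, ..., N.
   Permutations act on the left, by (g f)(x) = g (f x); since the product of
   {perm T} composes from left to right, the group law for which this is a left
   action is (g, h) |-> (h * g)%g. *)
Section Specht.
Local Open Scope set_scope.
Variables (N : nat) (sh : seq nat).

Definition cell := {i : 'I_(size sh) & 'I_(nth 0%N sh i)}.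
Definition row_of (c : cell) : nat := tag c.
Definition col_of (c : cell) : nat := tagged c.

Definition filling := {ffun cell -> 'I_N}.

Definition tableau (T : filling) : bool :=
  [forall x, #|[pred c | T c == x]| == 1%N].

Definition standard (T : filling) : bool :=
  tableau T && [forall c, forall c',
    ((row_of c == row_of c') && (col_of c < col_of c')%N ||
     (col_of c == col_of c') && (row_of c < row_of c')%N) ==> (T c < T c')%N].

Definition perm_filling (g : {perm 'I_N}) (T : filling) : filling :=
  [ffun c => g (T c)].

Definition row_equiv (T T' : filling) : bool :=
  [forall c, forall c', (T c == T' c') ==> (row_of c == row_of c')].

(* The tabloid {T} is the row equivalence class of T. *)
Definition tabloid (T : filling) : {set filling} :=
  finset (fun T' => tableau T' && row_equiv T T').

Definition perm_tabloid (g : {perm 'I_N}) (t : {set filling}) : {set filling} :=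
  imset (perm_filling g) (mem t).

Definition col_stab (T : filling) : {set {perm 'I_N}} :=
  finset (fun g : {perm 'I_N} => [forall c, forall c',
    (g (T c) == T c') ==> (col_of c == col_of c')]).

(* The Q-vector space of functions on sets of fillings; the permutation module
   on the tabloids of shape sh is the subspace of the functions supported on
   tabloids. *)
Definition tabloid_space := {ffun {set filling} -> rat}.

Definition tabloid_vec (t : {set filling}) : tabloid_space :=
  [ffun u => (u == t)%:R].

(* The linear action with perm_act g (tabloid_vec t)
   = tabloid_vec (perm_tabloid g t). *)
Definition perm_act (g : {perm 'I_N}) (v : tabloid_space) : tabloid_space :=
  [ffun t => v (perm_tabloid g^-1%g t)].

Definition polytabloid (T : filling) : tabloid_space :=
  \sum_(g in col_stab T)
    tabloid_vec (perm_tabloid g (tabloid T)) *~ ((-1) ^+ (odd_perm g)).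

Definition specht_lattice : set tabloid_space :=
  (fun v => exists a : filling -> int,
     v = \sum_(T : filling | standard T) polytabloid T *~ a T).

End Specht.

Local Open Scope classical_set_scope.

Definition hook_shape (n : nat) : seq nat := 2%N :: nseq n.-1 1%N.

Section SolomonZeta.
Variables (gT : Type) (V : zmodType) (act : gT -> V -> V).

Definition is_sublattice (M L : set V) : Prop :=
  [/\ L `<=` M, L 0, forall x y, L x -> L y -> L (x - y)
    & forall g x, L x -> L (act g x)].

Definition cosets (M L : set V) : set (set V) :=
  [set [set x + y | y in L] | x in M].

(* |M : L|, meaningful when the set of cosets is finite. *)
Definition lattice_index (M L : set V) : nat := #|` fset_set (cosets M L)|.

Definition finite_index_sublattices (M : set V) : set (set V) :=
  [set L | is_sublattice M L /\ finite_set (cosets M L)].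

End SolomonZeta.

Section Zeta.
Variable R : realType.

Definition cexp (z : R[i]) : R[i] :=
  (expR (complex.Re z))%:C * (cos (complex.Im z) +i* sin (complex.Im z)).

(* m ^ z for m > 0. *)
Definition nat_cpow (m : nat) (z : R[i]) : R[i] := cexp (z * (ln m%:R)%:C).

(* The Dirichlet series sum_(k >= 1) k ^ (-s), meaningful for Re s > 1. *)
Definition riemann_zeta (s : R[i]) : R[i] :=
  limn (series (fun k => nat_cpow k.+1 (- s) : R[i]^o)).

Definition solomon_term (gT : Type) (V : zmodType) (act : gT -> V -> V)
    (M : set V) (s : R[i]) (L : finite_index_sublattices act M) : R[i]^o :=
  nat_cpow (lattice_index M (val L)) (- s).

(* Unconditional (equivalently, absolute) convergence of the series defining
   the Solomon zeta function at s. *)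
Definition solomon_cvg (gT : Type) (V : zmodType) (act : gT -> V -> V)
    (M : set V) (s : R[i]) : Prop :=
  cvg (partial_sum (@solomon_term gT V act M s) @ totally).

Definition solomon_zeta (gT : Type) (V : zmodType) (act : gT -> V -> V)
    (M : set V) (s : R[i]) : R[i] :=
  summability.sum (@solomon_term gT V act M s).

(* The division by 'X - 1 is exact. *)
Definition phi (p m : nat) : {poly R[i]} :=
  ('X^((logn p m).+1) - 1) %/ ('X - 1).

End Zeta.

(* Main.v *)
Require Import Defs.
From HB Require Import structures.
From mathcomp Require Import all_boot all_order all_algebra fingroup perm.
From mathcomp Require Import complex.
From mathcomp Require Import finmap all_classical all_reals all_analysis.
From mathcomp Require Import summability zify ring lra.
Import Order.TTheory GRing.Theory Num.Theory numFieldNormedType.Exports.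
Local Open Scope ring_scope.

(* Let N = n + 1. Summing sgn(k) k{T0} over the permutations k that put j in the
   cell (0, 1) gives vectors f_0, ..., f_n with g f_j = sgn(g) f_(g j), whose
   only linear relation is f_0 + ... + f_n = 0, and which generate the Specht
   lattice; up to the sign character, the lattice is Z^N / Z(1, ..., 1).
   If a sublattice L contains x = sum a_j f_j, then it contains
   x + (i j) x = (a_i - a_j) (f_i - f_j), hence every
   (a_i - a_j) (f_k - f_l). With m the gcd of the a_i - a_j over all x in L,
   L lies between m times the span of the f_k - f_l and m times the Specht
   lattice. The quotient of these two is Z/N, so that
   L = {m sum b_j f_j : d | sum b_j} for a unique pair (m, d) with d | N, and L
   has index m^n d. *)

Set Implicit Arguments.
Unset Strict Implicit.
Unset Printing Implicit Defensive.

(** * Sublattices of Z^N / Z(1, ..., 1) *)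

Lemma perm_two (T : finType) (i j k l : T) : i != j -> k != l ->
  exists g : {perm T}, g i = k /\ g j = l.
Proof.
move=> ij kl; exists (tperm i k * tperm (tperm i k j) l)%g.
rewrite !permM !tpermL tpermD//; last by rewrite eq_sym.
by rewrite -[X in _ != X](tpermL i k) (inj_eq perm_inj) eq_sym.
Qed.

(** Division with remainder by the least positive element of [P]; the nonzero member [c], or its
    opposite, shows that there is one. *)
Lemma int_subgroupP (P : int -> Prop) (c : int) :
  P 0 -> (forall x y, P x -> P y -> P (x - y)) -> P c -> c != 0 ->
  exists2 d : nat, (0 < d)%N & forall x, P x <-> (d%:Z %| x)%Z.
Proof.
move=> P0 PB Pc c0.
have PN x : P x -> P (- x) by move=> Px; rewrite -sub0r; exact: PB.
have PD x y : P x -> P y -> P (x + y).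
  by move=> Px Py; rewrite -[y]opprK; apply: PB => //; exact: PN.
have PMn x k : P x -> P (x *+ k).
  by move=> Px; elim: k => [|k IH]; rewrite ?mulr0n // mulrS; exact: PD.
have PM x z : P x -> P (z * x).
  move=> Px; case: (intP z) => [|k|k]; rewrite ?mul0r //.
    by rewrite -natz mulr_natl; exact: PMn.
  by rewrite mulNr; apply: PN; rewrite -natz mulr_natl; exact: PMn.
pose Q (k : nat) := (0 < k)%N && `[< P k%:Z >].
have Qex : exists k, Q k.
  exists `|c|%N; rewrite /Q absz_gt0 c0 /=; apply/asboolP.
  by case: (intP c) Pc => // k /PN; rewrite ?opprK ?abszN // -abszN opprK.
case: (ex_minnP Qex) => d /andP[d0 /asboolP Pd] dmin.
exists d => // x; split=> [Px|/dvdzP[z ->]]; last exact: PM.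
have Pr : P (x %% d%:Z)%Z by rewrite /modz; apply: PB => //; exact: PM.
have r0 : 0 <= (x %% d%:Z)%Z by rewrite modz_ge0// lt0r_neq0.
have rd : (x %% d%:Z)%Z < d by rewrite ltz_pmod.
apply/dvdz_mod0P.
move: Pr r0 rd; case: (x %% d%:Z)%Z => // r Pr _ rd.
case: r Pr rd => // r Pr rd; have := dmin r.+1; rewrite /Q /=.
by move/(_ (asboolT Pr)); lia.
Qed.

Section Index.
Local Open Scope classical_set_scope.

(** Since [iota] separates exactly the cosets, a section [r] of it gives a bijection from [T] onto
    the cosets. The invariant lives on parameters [a] rather than on elements of [M], because an
    element may have many coefficient families. *)
Lemma index_of_invariant (V : zmodType) (M L : set V) (A : Type) (c : A -> V)
    (T : finType) (iota : A -> T) :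
  (forall x, M x <-> exists a, x = c a) ->
  L 0 -> (forall x y, L x -> L y -> L (x - y)) ->
  (forall a b, L (c a - c b) <-> iota a = iota b) ->
  (forall t, exists a, iota a = t) ->
  finite_set (cosets M L) /\ lattice_index M L = #|T|.
Proof.
move=> McP L0 LB iotaP /choice[r rK].
pose F (t : T) : set V := [set c (r t) + y | y in L].
have LN x : L x -> L (- x) by move=> Lx; rewrite -sub0r; exact: LB.
have LD x y : L x -> L y -> L (x + y).
  by move=> Lx Ly; rewrite -[y]opprK; apply: LB => //; exact: LN.
have cosE : cosets M L = F @` setT.
  apply/seteqP; split=> [_ [x /McP[a ->] <-]|_ [t _ <-]].
    exists (iota a) => //.
    have Lra : L (c (r (iota a)) - c a) by apply/iotaP; rewrite rK.
    apply/seteqP; split=> [_ [y Ly <-]|_ [y Ly <-]].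
      exists ((c (r (iota a)) - c a) + y); first exact: LD.
      by rewrite addrA [c a + _]addrC subrK.
    exists (y - (c (r (iota a)) - c a)); first exact: LB.
    by rewrite opprB addrCA subrKC addrC.
  by exists (c (r t)) => //; apply/McP; exists (r t).
have Finj : {in setT &, injective F}.
  move=> t u _ _ Ftu; rewrite -(rK t) -(rK u); apply/iotaP.
  have : F t (c (r t)) by exists 0; rewrite // addr0.
  by rewrite Ftu => -[y Ly <-]; rewrite addrC addKr.
have fT : finite_set [set: T] by exact: finite_finset.
split; first by rewrite cosE; exact: finite_image.
rewrite /lattice_index cosE fset_set_image// card_in_imfset /=; last first.
  by move=> t u _ _; apply: Finj; rewrite in_setE.
rewrite cardE; apply/perm_size/uniq_perm; rewrite ?fset_uniq ?enum_uniq//.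
by move=> t; rewrite mem_enum in_fset_set// in_setT.
Qed.
End Index.

Section Sublattices.
Local Open Scope classical_set_scope.
Variables (n : nat) (V : zmodType) (act : {perm 'I_n.+1} -> V -> V).
Variable f : 'I_n.+1 -> V.

Definition comb (a : 'I_n.+1 -> int) : V := \sum_j f j *~ a j.

Definition lattice_of : set V := [set v | exists a, v = comb a].

(** When the only relation is that the [f j] sum to zero and [m] is positive, the element fixes [b]
    up to a constant, and hence its sum modulo [n.+1]. The divisibility is therefore intrinsic for
    [d] dividing [n.+1]. *)
Definition scaled_sublattice (m d : nat) : set V :=
  [set v | exists2 b, v = comb (fun j => m%:Z * b j) & (d%:Z %| \sum_j b j)%Z].

Lemma combB a b : comb a - comb b = comb (fun j => a j - b j).
Proof. by rewrite /comb -sumrB; apply: eq_bigr => j _; rewrite mulrzBr. Qed.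

Lemma combD a b : comb a + comb b = comb (fun j => a j + b j).
Proof. by rewrite /comb -big_split; apply: eq_bigr => j _; rewrite mulrzDr. Qed.

Lemma combZ c a : comb (fun j => c * a j) = comb a *~ c.
Proof.
by rewrite /comb mulrz_suml; apply: eq_bigr => j _; rewrite mulrC mulrzA.
Qed.

Lemma comb0 : comb (fun=> 0) = 0.
Proof. by rewrite /comb big1 // => j _; rewrite mulr0z. Qed.

Lemma eq_comb a b : a =1 b -> comb a = comb b.
Proof. by move=> ab; apply: eq_bigr => j _; rewrite ab. Qed.

Lemma comb_delta i c : comb (fun k => (k == i)%:R * c) = f i *~ c.
Proof.
rewrite /comb (bigD1 i)//= eqxx mul1r big1 ?addr0// => k /negPf->.
by rewrite mul0r mulr0z.
Qed.

Hypothesis n2 : (2 <= n)%N.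
Hypothesis actB : forall g x y, act g (x - y) = act g x - act g y.
Hypothesis act_f : forall g j, act g (f j) = f (g j) *~ ((-1) ^+ odd_perm g).
Hypothesis sum_f : \sum_j f j = 0.
Hypothesis comb_eq0 : forall a, comb a = 0 -> forall i j, a i = a j.

Lemma comb_const c : comb (fun=> c) = 0.
Proof. by rewrite /comb -mulrz_suml sum_f mul0rz. Qed.

Lemma comb_shift c a : comb (fun j => a j + c) = comb a.
Proof. by rewrite -combD comb_const addr0. Qed.

Lemma comb_inj a b : comb a = comb b -> exists c, forall j, a j = b j + c.
Proof.
move=> ab; exists (a ord0 - b ord0) => j.
have /comb_eq0/(_ j ord0) : comb (fun j => a j - b j) = 0.
  by rewrite -combB ab subrr.
by move=> <-; rewrite subrKC.
Qed.

Lemma act0 g : act g 0 = 0.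
Proof. by rewrite -[0 in LHS](subrr 0) actB subrr. Qed.

Lemma actN g x : act g (- x) = - act g x.
Proof. by rewrite -[- x]sub0r actB act0 sub0r. Qed.

Lemma actD g x y : act g (x + y) = act g x + act g y.
Proof. by rewrite -[y]opprK actB actN !opprK. Qed.

Lemma actMz g x c : act g (x *~ c) = act g x *~ c.
Proof.
have Mn k : act g (x *+ k) = act g x *+ k.
  by elim: k => [|k IH]; rewrite ?mulr0n ?act0// !mulrS actD IH.
by case: c => k; rewrite /intmul ?actN Mn.
Qed.

Lemma act_comb g a :
  act g (comb a) = comb (fun j => (-1) ^+ odd_perm g * a (g^-1%g j)).
Proof.
rewrite /comb (big_morph (act g) (actD g) (act0 g)).
rewrite [RHS](reindex_inj (@perm_inj _ g)); apply: eq_bigr => j _ /=.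
by rewrite actMz act_f permK mulrzA.
Qed.

Lemma scaled_sublatticeP m d : (d %| n.+1)%N ->
  is_sublattice act lattice_of (scaled_sublattice m d).
Proof.
move=> dN; split.
- by move=> v [b -> _]; exists (fun j => m%:Z * b j).
- by exists (fun=> 0); [rewrite comb_const // mulr0 comb0|rewrite big1 ?dvdz0].
- move=> x y [b -> db] [c -> dc]; exists (fun j => b j - c j).
    by rewrite combB; apply: eq_comb => j; rewrite mulrBr.
  by rewrite sumrB rpredB.
- move=> g x [b -> db]; exists (fun j => (-1) ^+ odd_perm g * b (g^-1%g j)).
    by rewrite act_comb; apply: eq_comb => j; rewrite mulrCA.
  rewrite -mulr_sumr dvdz_mull//.
  by rewrite [X in (_ %| X)%Z](reindex_inj (@perm_inj _ g^-1%g)) in db.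
Qed.

(** The invariant of [comb a] is read off after normalising the coefficient at [ord0] to zero ([y]).
    The residues modulo m of the other n coefficients take m^n values, and the sum of the quotients
    modulo d takes d values. *)
Lemma scaled_sublattice_index m d :
  (0 < m)%N -> (0 < d)%N -> (d %| n.+1)%N ->
  finite_set (cosets lattice_of (scaled_sublattice m d)) /\
  lattice_index lattice_of (scaled_sublattice m d) = (m ^ n * d)%N.
Proof.
case: m => // m; case: d => // d _ _ dN.
have [_ L0 LB _] := scaled_sublatticeP m.+1 dN.
pose y (a : 'I_n.+1 -> int) j := a j - a ord0.
pose res k (x : int) : 'I_k.+1 := inord `|(x %% k.+1%:Z)%Z|%N.
have resP k x z : (res k x = res k z) <-> (k.+1%:Z %| x - z)%Z.
  have rlt u : (`|(u %% k.+1%:Z)%Z|%N < k.+1)%N.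
    by rewrite -ltz_nat gez0_abs ?modz_ge0// ltz_pmod.
  rewrite -eqz_mod_dvd.
  split=> [/(congr1 val)|/eqP xz]; last by rewrite /res xz.
  rewrite /= !inordK// => /(congr1 Posz).
  by rewrite !gez0_abs ?modz_ge0// => ->.
pose iota a : {ffun 'I_n -> 'I_m.+1} * 'I_d.+1 :=
  ([ffun i => res m (y a (lift ord0 i))],
   res d (\sum_j (y a j %/ m.+1%:Z)%Z)).
have -> : (m.+1 ^ n * d.+1)%N = #|{: {ffun 'I_n -> 'I_m.+1} * 'I_d.+1}|.
  by rewrite card_prod card_ffun !card_ord.
apply: (index_of_invariant (c := comb) (iota := iota)) => //.
- move=> a b; rewrite combB; split.
    move=> [c /comb_inj[e ace] dc].
    have yE j : y a j = (c j - c ord0) * m.+1 + y b j.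
      by have := ace j; have := ace ord0; rewrite /y; nia.
    congr pair.
      apply/ffunP => i; rewrite !ffunE; apply/resP.
      by rewrite yE addrK dvdz_mull.
    (* The quotients differ by [c j - c ord0], with sum (sum of c) - (n+1) c_0; this is divisible by
       d because d divides n+1. *)
    apply/resP; rewrite -sumrB.
    under eq_bigr do rewrite yE divzMDl// addrK.
    rewrite sumrB rpredB// sumr_const card_ord -mulr_natr natz.
    by rewrite dvdz_mull.
  move=> [/ffunP yab /resP]; rewrite -sumrB => dy.
  (* A constant shift turns [a - b] into [y a - y b]; as the residues agree, this is [m.+1] times
     the difference of the quotients. *)
  exists (fun j => (y a j %/ m.+1%:Z)%Z - (y b j %/ m.+1%:Z)%Z) => //.
  rewrite -(comb_shift (b ord0 - a ord0)); apply: eq_comb => j.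
  have : (m.+1%:Z %| y a j - y b j)%Z.
    case: (unliftP ord0 j) => [i ->|->]; last by rewrite /y !subrr dvdz0.
    by apply/resP; have := yab i; rewrite !ffunE.
  rewrite -eqz_mod_dvd => /eqP.
  have := divz_eq (y a j) m.+1; have := divz_eq (y b j) m.+1.
  rewrite /y; nia.
- move=> [u w].
  (* The residues are prescribed by [u]. Adding [w] times the modulus at a single index makes the
     quotient [w] there and 0 elsewhere, so that the quotients sum to [w]. *)
  pose x (i : 'I_n) : int :=
    (u i : nat)%:Z + (i == 0 :> nat)%:R * (w : nat)%:Z * m.+1%:Z.
  exists (fun j => if unlift ord0 j is Some i then x i else 0).
  have y0 : y (fun j => if unlift ord0 j is Some i then x i else 0) ord0 = 0.
    by rewrite /y subrr.
  have yS i : y (fun j => if unlift ord0 j is Some i then x i else 0)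
     (lift ord0 i) = x i by rewrite /y liftK unlift_none subr0.
  have resE k (i : 'I_k.+1) : res k (i : nat)%:Z = i.
    apply: val_inj; rewrite /= inordK modz_nat absz_nat modn_small//.
  congr pair.
    apply/ffunP => i; rewrite ffunE yS -[RHS]resE; apply/resP.
    by rewrite /x addrAC subrr add0r dvdz_mull.
  rewrite -[RHS]resE; apply/resP.
  rewrite big_ord_recl y0 div0z add0r.
  have i0 : (0 < n)%N by exact: ltn_trans n2.
  rewrite (bigD1 (Ordinal i0))//= yS /x /= mul1r divzDr ?dvdz_mull// mulzK//.
  rewrite divz_small ?add0r; last by rewrite lez_nat ltz_nat /=.
  rewrite big1 ?addr0 ?subrr ?dvdz0// => i inz.
  rewrite yS /x (_ : (i == 0 :> nat) = false) ?mul0r ?addr0.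
    by rewrite divz_small// lez_nat ltz_nat /=.
  by apply/negP => /eqP ie; move/eqP: inz; apply; exact: val_inj.
Qed.

(** The coefficients c and -c sum to zero, so the divisibility condition holds for every [d]. *)
Lemma diff_mem_scaled (m : nat) i j (c : int) d :
  scaled_sublattice m d ((f i - f j) *~ (m%:Z * c)).
Proof.
exists (fun k => (k == i)%:R * c - (k == j)%:R * c); last first.
  rewrite sumrB -!mulr_suml (bigD1 i)//= eqxx big1 => [|k /negPf->//].
  by rewrite (bigD1 j)//= eqxx big1 ?subrr ?dvdz0// => k /negPf->.
rewrite combZ -combB !comb_delta -mulrzBl -mulrzA.
by rewrite mulrC.
Qed.

(** The element m (f_1 - f_0) of the smaller lattice has coefficients m' b_j up to a common
    constant. Comparing indices 1 and 2 gives m = m' (b_1 - b_2), whereas indices 1 and 0 would only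
    give 2m; hence a third index, that is n >= 2. *)
Lemma scaled_sublattice_dvd m d m' d' : (0 < m)%N ->
  scaled_sublattice m d `<=` scaled_sublattice m' d' -> (m' %| m)%N.
Proof.
move=> m0 sub.
pose i1 : 'I_n.+1 := inord 1; pose i2 : 'I_n.+1 := inord 2.
have i1E : (i1 == ord0) = false by rewrite -val_eqE /= inordK// ltnS ltnW.
have i20 : (i2 == ord0) = false by rewrite -val_eqE /= inordK.
have i21 : (i2 == i1) = false.
  by rewrite -val_eqE /= !inordK// ltnS ltnW.
have /sub[b] := diff_mem_scaled m i1 ord0 1 d.
rewrite mulr1 mulrzBl -!comb_delta combB => /comb_inj[c bc] _.
have := bc i2; have := bc i1.
rewrite i21 i20 i1E eqxx !mul0r mul1r !subr0 => e1 e2.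
have {e1 e2} mE : m%:Z = (b i1 - b i2) * m'%:Z by lia.
have : (m'%:Z %| m%:Z)%Z by rewrite mE dvdz_mull.
by rewrite dvdzE.
Qed.

(** Inclusion in both directions determines m; the index m^n d then determines d. *)
Lemma scaled_sublattice_inj m d m' d' :
  (0 < m)%N -> (0 < m')%N -> (0 < d)%N -> (0 < d')%N ->
  (d %| n.+1)%N -> (d' %| n.+1)%N ->
  scaled_sublattice m d = scaled_sublattice m' d' -> m = m' /\ d = d'.
Proof.
move=> m0 m'0 d0 d'0 dN d'N e.
have mm' : m = m'.
  apply/eqP; rewrite eqn_dvd; apply/andP; split.
    by apply: (@scaled_sublattice_dvd m' d' m d) => //; rewrite e.
  by apply: (@scaled_sublattice_dvd m d m' d') => //; rewrite e.
split=> //; subst m'.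
have [_ i1] := scaled_sublattice_index m0 d0 dN.
have [_ i2] := scaled_sublattice_index m0 d'0 d'N.
move: i2; rewrite -e i1 => /eqP; rewrite eqn_pmul2l ?expn_gt0 ?m0// => /eqP//.
Qed.

Lemma sublattice_classification L :
  is_sublattice act lattice_of L -> finite_set (cosets lattice_of L) ->
  exists m d, [/\ (0 < m)%N, (0 < d)%N, (d %| n.+1)%N
                & L = scaled_sublattice m d].
Proof.
move=> [LM L0 LB Lact] Lfin.
have LN x : L x -> L (- x) by move=> Lx; rewrite -sub0r; exact: LB.
have LD x y : L x -> L y -> L (x + y).
  by move=> Lx Ly; rewrite -[y]opprK; apply: LB => //; exact: LN.
(* A transposition is odd, so it sends [comb a] to minus the combination with the coefficients at
   [i] and [j] exchanged. Adding [comb a] leaves only these two positions. *)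
have Lswap a i j : L (comb a) -> L ((f i - f j) *~ (a i - a j)).
  move=> La; have [<-|ij] := eqVneq i j; first by rewrite subrr mul0rz.
  have -> : (f i - f j) *~ (a i - a j) = comb a + act (tperm i j) (comb a).
    rewrite act_comb combD mulrzBl -!comb_delta combB; apply: eq_comb => k.
    rewrite odd_tperm ij expr1 tpermV mulN1r.
    case: tpermP => [->|->|/eqP/negPf-> /eqP/negPf->].
    - by rewrite eqxx (negPf ij) mul1r mul0r subr0.
    - by rewrite eqxx eq_sym (negPf ij) mul1r mul0r sub0r opprB.
    - by rewrite !mul0r !subrr.
  by apply: LD => //; exact: Lact.
(* By double transitivity one difference is carried to any other; the sign is absorbed since [L] is
   closed under opposites. *)
have Ltrans i j k l c : i != j -> L ((f i - f j) *~ c) -> L ((f k - f l) *~ c).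
  move=> ij Lij; have [<-|kl] := eqVneq k l; first by rewrite subrr mul0rz.
  have [g [gi gj]] := perm_two ij kl.
  have := Lact g _ Lij; rewrite actMz actB !act_f gi gj -mulrzBl.
  case: (odd_perm g); rewrite ?expr0 ?expr1 ?mulr1z// mulrN1z mulNrz => /LN.
  by rewrite opprK.
pose C (c : int) := forall i j, L ((f i - f j) *~ c).
have n0 : (0 < n)%N by exact: ltn_trans n2.
have i01 : (ord0 : 'I_n.+1) != ord_max by rewrite -val_eqE /= eq_sym -lt0n.
have Cof a i j : L (comb a) -> C (a i - a j).
  move=> /Lswap La k l.
  have [<-|ij] := eqVneq i j; first by rewrite subrr mulr0z.
  exact: Ltrans ij (La i j).
(* Pigeonhole: the multiples of [v] fall into finitely many cosets, so two distinct ones are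
   congruent modulo [L]. *)
have [c Cc c0] : exists2 c, C c & c != 0.
  pose v := f ord0 - f ord_max.
  have Mv k : lattice_of (v *~ k).
    exists (fun j => (j == ord0)%:R * k - (j == ord_max)%:R * k).
    by rewrite -combB !comb_delta mulrzBl.
  pose cs (k : nat) := [set v *~ k%:Z + y | y in L].
  have csP k : cosets lattice_of L (cs k) by exists (v *~ k%:Z).
  have [k [l [kl kle]]] : exists k l, k <> l /\ cs k = cs l.
    apply: contrapT => ncs; apply: infinite_nat.
    apply: (@sub_finite_set _ _ (cs @^-1` cosets lattice_of L)).
      by move=> k _; exact: csP.
    apply: finite_preimage Lfin => k l _ _ kl; apply: contrapT => neq.
    by apply: ncs; exists k, l.
  exists (k%:Z - l%:Z); last by rewrite subr_eq0 eqz_nat; apply/eqP.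
  move=> i j; apply: Ltrans i01 _; rewrite mulrzBr.
  have : cs k (v *~ k) by exists 0; rewrite // addr0.
  by rewrite kle => -[y Ly <-]; rewrite addrC addKr.
have [||m m0 mP] := int_subgroupP _ _ Cc c0.
- by move=> i j; rewrite mulr0z.
- by move=> x y Cx Cy i j; rewrite mulrzBr; exact: LB.
(* Subtracting [a ord0] from all coefficients does not change [v], and the differences
   [a j - a ord0] lie in [C], so [m] divides them. *)
have LE v : L v -> exists b, v = comb (fun j => m%:Z * b j).
  move=> Lv; have [a va] := LM _ Lv.
  exists (fun j => ((a j - a ord0) %/ m%:Z)%Z).
  rewrite va -(comb_shift (- a ord0)); apply: eq_comb => j.
  by rewrite mulrC divzK//; apply/mP; apply: Cof; rewrite -va.
(* The coefficient sums occurring in [L] form a subgroup. It contains n+1, since the constant family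
   1 represents zero; so its generator d divides n+1. *)
pose D (e : int) :=
  exists2 b, L (comb (fun j => m%:Z * b j)) & \sum_j b j = e.
have [||||d d0 dP] := @int_subgroupP D n.+1%:Z.
- exists (fun=> 0); last by rewrite big1.
  by under eq_comb do rewrite mulr0; rewrite comb0.
- move=> x y [b Lb <-] [b' Lb' <-]; exists (fun j => b j - b' j).
    under eq_comb do rewrite mulrBr.
    by rewrite -combB; exact: LB.
  by rewrite sumrB.
- exists (fun=> 1); first by rewrite comb_const.
  by rewrite sumr_const card_ord natz.
- by [].
exists m, d; split=> //.
  have : D n.+1%:Z.
    exists (fun=> 1); first by rewrite comb_const.
    by rewrite sumr_const card_ord natz.
  by move=> /dP; rewrite dvdzE.
apply/seteqP; split=> [v Lv|v [b -> /dP[b' Lb' bb']]].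
  have [b vb] := LE _ Lv; exists b => //; apply/dP; exists b => //.
  by rewrite -vb.
(* The families [b] and [b'] have the same sum, so the difference is a combination of the
   [f j - f ord0] with coefficients divisible by [m], all of which lie in [L]. *)
rewrite -[comb _](subrK (comb (fun j => m%:Z * b' j))); apply: (LD) => //.
have -> : comb (fun j => m%:Z * b j) - comb (fun j => m%:Z * b' j) =
          \sum_j (f j - f ord0) *~ (m%:Z * (b j - b' j)).
  under [RHS]eq_bigr do rewrite mulrzBl.
  rewrite sumrB -mulrz_sumr -mulr_sumr sumrB bb' subrr mulr0 mulr0z subr0.
  by rewrite combB; apply: eq_bigr => j _; rewrite mulrBr.
apply: (big_ind L L0 LD) => j _.
by have /mP : (m%:Z %| m%:Z * (b j - b' j))%Z by exact: dvdz_mulr.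
Qed.
End Sublattices.

(** * Generators of the Specht lattice of a hook *)

Lemma mulrz_signD (V : zmodType) (v : V) (b c : bool) :
  v *~ ((-1) ^+ (b (+) c)) = v *~ ((-1) ^+ b) *~ ((-1) ^+ c).
Proof. by rewrite -mulrzA -signr_addb. Qed.

(** * Permutations acting on fillings and tabloids *)

Section Tabloids.
Local Open Scope group_scope.
Variables (N : nat) (sh : seq nat).
Implicit Types (T : filling N sh) (g h : {perm 'I_N}) (t : {set filling N sh}).

Lemma perm_fillingM g h T :
  perm_filling (g * h) T = perm_filling h (perm_filling g T).
Proof. by apply/ffunP => c; rewrite !ffunE permM. Qed.

Lemma perm_filling1 T : perm_filling 1 T = T.
Proof. by apply/ffunP => c; rewrite !ffunE perm1. Qed.

Lemma perm_fillingK g : cancel (@perm_filling N sh g) (perm_filling g^-1).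
Proof. by move=> T; rewrite -perm_fillingM mulgV perm_filling1. Qed.

Lemma perm_fillingKV g : cancel (perm_filling g^-1) (@perm_filling N sh g).
Proof. by move=> T; rewrite -perm_fillingM mulVg perm_filling1. Qed.

Lemma mem_perm_tabloid g t T :
  (T \in perm_tabloid g t) = (perm_filling g^-1 T \in t).
Proof.
apply/imsetP/idP => [[T' T't ->]|Tt]; first by rewrite perm_fillingK.
by exists (perm_filling g^-1 T); rewrite ?perm_fillingKV.
Qed.

Lemma perm_tabloidM g h t :
  perm_tabloid (g * h) t = perm_tabloid h (perm_tabloid g t).
Proof.
by apply/setP => T; rewrite !mem_perm_tabloid invMg perm_fillingM.
Qed.

Lemma perm_tabloid1 t : perm_tabloid 1 t = t.
Proof. by apply/setP => T; rewrite mem_perm_tabloid invg1 perm_filling1. Qed.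

Lemma perm_actB g (v w : tabloid_space N sh) :
  perm_act g (v - w)%R = (perm_act g v - perm_act g w)%R.
Proof. by apply/ffunP => t; rewrite !ffunE. Qed.

Lemma perm_act_vec g t :
  perm_act g (tabloid_vec t) = tabloid_vec (perm_tabloid g t).
Proof.
apply/ffunP => u; rewrite !ffunE; congr (nat_of_bool _)%:R%R.
apply/eqP/eqP => [<-|->]; rewrite -perm_tabloidM.
  by rewrite mulVg perm_tabloid1.
by rewrite mulgV perm_tabloid1.
Qed.

Lemma tableauP T :
  tableau T -> injective T /\ forall x, exists c : cell sh, T c = x.
Proof.
move=> /forallP tT; split=> [c c' cc'|x].
  have /card1P[y yP] := tT (T c).
  have := yP c; have := yP c'; rewrite !inE cc' eqxx.
  by move=> /esym/eqP-> /esym/eqP->.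
have /card1P[y yP] := tT x.
by exists y; have := yP y; rewrite !inE eqxx => /eqP.
Qed.

Lemma inj_tableau T :
  injective T -> (forall x, exists c : cell sh, T c = x) -> tableau T.
Proof.
move=> injT surT; apply/forallP => x; apply/card1P.
have [c <-] := surT x; exists c => c'.
by rewrite !inE (inj_eq injT).
Qed.

Lemma perm_tableau g T : tableau T -> tableau (perm_filling g T).
Proof.
move=> /tableauP[injT surT]; apply: inj_tableau => [c c'|x].
  by rewrite !ffunE => /perm_inj/injT.
have [c cx] := surT (g^-1 x).
by exists c; rewrite ffunE cx permKV.
Qed.

Lemma tableau_perm T T' : tableau T -> tableau T' ->
  exists g, T' = perm_filling g T.
Proof.
move=> /tableauP[injT surT] /tableauP[injT' _].
have [r rK] := choice surT.
have h_inj : injective (fun x => T' (r x)).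
  by move=> x y /injT' e; rewrite -(rK x) e rK.
exists (perm h_inj); apply/ffunP => c; rewrite ffunE permE.
by congr (T' _); apply: injT; rewrite rK.
Qed.

Lemma tabloid_perm g T :
  tabloid (perm_filling g T) = perm_tabloid g (tabloid T).
Proof.
apply/setP => T'; rewrite mem_perm_tabloid !inE; congr (_ && _).
  apply/idP/idP => [|/(perm_tableau g)]; first exact: perm_tableau.
  by rewrite perm_fillingKV.
apply: eq_forallb => c; apply: eq_forallb => c'; rewrite !ffunE.
by rewrite (can2_eq (permK g) (permKV g)).
Qed.

Lemma sub_tabloid T T' :
  (forall c, exists2 c', T' c = T c' & row_of c' = row_of c) ->
  tabloid T \subset tabloid T'.
Proof.
move=> TT'; apply/fintype.subsetP => U; rewrite !inE => /andP[-> /=].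
move=> /forallP TU.
apply/forallP => c; apply/forallP => c'; apply/implyP.
have [d -> <-] := TT' c.
by have /forallP/(_ c')/implyP := TU d.
Qed.

End Tabloids.

(** * Cells, tableaux and polytabloids of hook shape *)

Section Hook.
Variable n : nat.
Hypothesis n2 : (2 <= n)%N.
Local Notation sh := (hook_shape n).
Local Notation N := n.+1.
Implicit Types (c : cell sh) (T : filling N sh) (g k : {perm 'I_N}).

Lemma size_hook_shape : size sh = n.
Proof. by rewrite /= size_nseq prednK// ltnW. Qed.

Lemma nth_hook_shape i : (i < n)%N -> nth 0%N sh i = (i == 0%N).+1.
Proof.
by case: i => // i; rewrite /= nth_nseq => i_n; case: ltnP => //; lia.
Qed.

Lemma hook_row c : (row_of c < n)%N.
Proof. by rewrite -[X in (_ < X)%N]size_hook_shape; exact: ltn_ord (tag c). Qed.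

Lemma hook_col c : (col_of c <= (row_of c == 0%N))%N.
Proof.
by rewrite -ltnS -(nth_hook_shape (hook_row c)); exact: ltn_ord (tagged c).
Qed.

Lemma cell_eq c c' : row_of c = row_of c' -> col_of c = col_of c' -> c = c'.
Proof.
case: c c' => [i x] [j y] /val_inj /= ij; subst j.
by move=> /val_inj /= ->.
Qed.

Lemma cell_at i j : (i < n)%N -> (j <= (i == 0%N))%N ->
  exists c, row_of c = i /\ col_of c = j.
Proof.
move=> i_n ji; have i_s : (i < size sh)%N by rewrite size_hook_shape.
have j_s : (j < nth 0%N sh (Ordinal i_s))%N by rewrite /= nth_hook_shape.
by exists (Tagged (fun i : 'I_(size sh) => 'I_(nth 0%N sh i)) (Ordinal j_s)).
Qed.

(** Here [j] fills the arm cell (0, 1), and [bump j] lists the other entries in increasing order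
    down the first column. *)
Definition hook_tableau (j : 'I_N) : filling N sh :=
  [ffun c => if col_of c == 0%N then inord (bump j (row_of c)) else j].

Lemma val_hook_tableau j c : col_of c = 0%N ->
  hook_tableau j c = bump j (row_of c) :> nat.
Proof.
move=> c0; rewrite ffunE c0 eqxx inordK// /bump.
by have := hook_row c; case: (j <= _)%N => /=; lia.
Qed.

Lemma hook_col_neq0 c : col_of c != 0%N -> row_of c = 0%N /\ col_of c = 1%N.
Proof. by have := hook_col c; case: eqP; case: (col_of c) => [|[]]. Qed.

Lemma hook_tableau_is_tableau j : tableau (hook_tableau j).
Proof.
apply: inj_tableau => [c c' cc'|x].
  have [c0|/hook_col_neq0[r0 c1]] := eqVneq (col_of c) 0%N;
  have [c'0|/hook_col_neq0[r'0 c'1]] := eqVneq (col_of c') 0%N.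
  - move/(congr1 val): cc'; rewrite /= !val_hook_tableau//.
    move=> /(can_inj (bumpK _)) cc'; by apply: cell_eq; rewrite ?c0.
  - move/(congr1 val): cc'; rewrite /= val_hook_tableau// ffunE c'1 /=.
    by move/eqP; rewrite eq_sym (negPf (neq_bump _ _)).
  - move/(congr1 val): cc'; rewrite /= [in RHS]val_hook_tableau// ffunE c1 /=.
    by move/eqP; rewrite (negPf (neq_bump _ _)).
  - by apply: cell_eq; rewrite ?r0 ?c1.
have [->|xj] := eqVneq x j.
  have [||c [_ c1]] := @cell_at 0 1 => //; first exact: ltnW.
  by exists c; rewrite ffunE c1.
have un : (unbump j x < n)%N.
  rewrite /unbump; have := ltn_ord x; have := ltn_ord j.
  by move: xj; rewrite -val_eqE /=; case: (ltnP j x) => /=; lia.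
have [//|c [cr c0]] := @cell_at (unbump j x) 0 un.
by exists c; apply: val_inj; rewrite /= val_hook_tableau// cr unbumpK.
Qed.

(** For nonzero [j] the corner entry [bump j 0] is 0, which is smaller than [j]; the column
    increases because [bump j] does. *)
Lemma hook_tableau_standard j : j != ord0 -> standard (hook_tableau j).
Proof.
move=> j0; rewrite /standard hook_tableau_is_tableau /=.
apply/forallP => c; apply/forallP => c'; apply/implyP.
have bump_lt a b : (a < b)%N -> (bump j a < bump j b)%N.
  by rewrite !ltnNge leq_bump2.
case/orP => /andP[/eqP e lt].
  have [r'0 c'1] : row_of (c' : cell sh) = 0%N /\ col_of (c' : cell sh) = 1%N.
    by apply: hook_col_neq0; rewrite -lt0n (leq_ltn_trans _ lt).
  have c0 : col_of (c : cell sh) = 0%N.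
    by move: lt; rewrite c'1 ltnS leqn0 => /eqP.
  rewrite val_hook_tableau// ffunE c'1 /= e r'0 /bump.
  by move: j0; rewrite -val_eqE /= leqn0 -lt0n => j0; rewrite eqn0Ngt j0.
have c'0 : col_of (c' : cell sh) = 0%N.
  apply/eqP/negP => /negP/hook_col_neq0[r'0 _].
  by rewrite r'0 in lt.
by rewrite !val_hook_tableau ?e// bump_lt.
Qed.

Section Base.
Variables (T0 : filling N sh) (c0 c1 : cell sh).
Hypotheses (tT0 : tableau T0) (row0 : row_of c0 = 0%N) (col0 : col_of c0 = 0%N).
Hypotheses (row1 : row_of c1 = 0%N) (col1 : col_of c1 = 1%N).
Let i0 := T0 c0.
Let j0 := T0 c1.
(** Only the top row of a hook has two cells, so [swap] generates the row stabilizer of [T0]. *)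
Let swap := tperm i0 j0.

Let injT0 : injective T0. Proof. by have [] := tableauP tT0. Qed.
Let surT0 x : exists c : cell sh, T0 c = x.
Proof. by have [_ /(_ x)] := tableauP tT0. Qed.

Let ij0 : i0 != j0.
Proof. by apply/eqP => /injT0 e; move: col0; rewrite e col1. Qed.

Lemma hook_row0 c : row_of c = 0%N -> c = c0 \/ c = c1.
Proof.
move=> r0; have [c_0|/hook_col_neq0[_ c_1]] := eqVneq (col_of c) 0%N.
  by left; apply: cell_eq; rewrite ?r0 ?c_0.
by right; apply: cell_eq; rewrite ?r0 ?c_1.
Qed.

Lemma hook_row_gt0 c c' : row_of c = row_of c' -> row_of c != 0%N -> c = c'.
Proof.
move=> rr r0; apply: cell_eq => //.
have cz (d : cell sh) : row_of d != 0%N -> col_of d = 0%N.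
  by move=> /negPf rd; have := hook_col d; rewrite rd leqn0 => /eqP.
by rewrite !cz// -rr.
Qed.

Lemma tabloid_swap : perm_tabloid swap (tabloid T0) = tabloid T0.
Proof.
have sw (c : cell sh) :
    exists2 c' : cell sh, swap (T0 c) = T0 c' & row_of c' = row_of c.
  rewrite /swap; case: tpermP => [/injT0->|/injT0->|_ _]; last by exists c.
    by exists c1; rewrite ?row0 ?row1.
  by exists c0; rewrite ?row0 ?row1.
rewrite -tabloid_perm; apply/eqP; rewrite finset.eqEsubset; apply/andP; split.
  apply: sub_tabloid => c; have [c' e r] := sw c.
  by exists c'; rewrite // ffunE -e tpermK.
by apply: sub_tabloid => c; have [c' e r] := sw c; exists c'; rewrite // ffunE.
Qed.

(** The quotient [u] of the two permutations preserves the rows of [T0]: it fixes every entry below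
    the top row and permutes [i0] and [j0], so it is 1 or [swap]. *)
Lemma tabloid_inj k k' :
  perm_tabloid k (tabloid T0) = perm_tabloid k' (tabloid T0) ->
  k' = k \/ k' = (swap * k)%g.
Proof.
move=> e.
have : perm_filling k T0 \in perm_tabloid k (tabloid T0).
  rewrite -tabloid_perm inE perm_tableau//=.
  apply/forallP => c; apply/forallP => c'; apply/implyP => /eqP.
  have [+ _] := tableauP (perm_tableau k tT0) => /[apply] ->.
  by [].
rewrite e mem_perm_tabloid -perm_fillingM inE => /andP[_ /forallP rT].
pose u := (k * k'^-1)%g.
have {rT} uT (c c' : cell sh) : T0 c = u (T0 c') -> row_of c = row_of c'.
  move=> ucc'; have /forallP/(_ c')/implyP := rT c.
  by rewrite ffunE ucc' eqxx => /(_ isT)/eqP.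
have ufix (c : cell sh) : row_of c != 0%N -> u (T0 c) = T0 c.
  move=> rc; have [c' c'E] := surT0 (u (T0 c)).
  have rr := uT _ _ c'E; rewrite -c'E.
  by congr (T0 _); apply: hook_row_gt0; rewrite ?rr.
have u0 (c : cell sh) : row_of c = 0%N -> u (T0 c) = i0 \/ u (T0 c) = j0.
  move=> rc; have [c' c'E] := surT0 (u (T0 c)).
  rewrite -c'E; have := uT _ _ c'E; rewrite rc => /hook_row0[] ->.
    by left.
  by right.
have uE : u = 1%g \/ u = swap.
  have ueq (v : {perm 'I_N}) : u i0 = v i0 -> u j0 = v j0 ->
      (forall x, x != i0 -> x != j0 -> v x = x) -> u = v.
    move=> vi vj vx; apply/permP => x; have [c <-] := surT0 x.
    have [/hook_row0[]-> //|rc] := eqVneq (row_of c) 0%N.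
    rewrite ufix// vx// inj_eq//; apply: contraNneq rc => ->; exact/eqP.
  have [ui|ui] := u0 _ row0; have [uj|uj] := u0 _ row1.
  - have := @perm_inj _ u i0 j0; rewrite ui uj => /(_ erefl) /eqP.
    by rewrite (negPf ij0).
  - by left; apply: ueq; rewrite ?perm1// => x; rewrite perm1.
  - right; apply: ueq; rewrite ?tpermL ?tpermR// => x xi xj.
    by rewrite tpermD// eq_sym.
  - have := @perm_inj _ u i0 j0; rewrite ui uj => /(_ erefl) /eqP.
    by rewrite (negPf ij0).
have k'E : k' = (u^-1 * k)%g by rewrite /u invMg invgK mulgKV.
by case: uE k'E => -> ->; [left; rewrite invg1 mul1g|right; rewrite tpermV].
Qed.

(** Up to sign this is the polytabloid of any tableau with [j] in the arm cell, as
    [polytabloid_perm] shows. The normalisation relative to [T0] treats all n+1 indices alike,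
    including [ord0], which never occupies the arm of a standard tableau. *)
Definition signed_polytabloid (j : 'I_N) : tabloid_space N sh :=
  \sum_(k : {perm 'I_N} | k j0 == j)
    tabloid_vec (perm_tabloid k (tabloid T0)) *~ ((-1) ^+ odd_perm k).
Local Notation f := signed_polytabloid.

Lemma perm_act_signed_polytabloid g j :
  perm_act g (f j) = f (g j) *~ ((-1) ^+ odd_perm g).
Proof.
have pA0 := act0 (@perm_actB N sh); have pAD := actD (@perm_actB N sh).
rewrite /f (big_morph (perm_act g) (pAD g) (pA0 g)) mulrz_suml.
rewrite [RHS](reindex_inj (mulIg g)) /=; apply: eq_big => k.
  by rewrite permM (inj_eq perm_inj).
move=> _; rewrite (actMz (@perm_actB N sh)) perm_act_vec -perm_tabloidM.
by rewrite odd_permM mulrz_signD -mulrzA -expr2 sqrr_sign mulr1z.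
Qed.

(** The total is the alternating sum over the whole symmetric group. The odd permutation [swap]
    fixes the tabloid of [T0], so the total equals its own opposite. *)
Lemma sum_signed_polytabloid : \sum_j f j = 0.
Proof.
rewrite /f; have -> : \sum_j f j = \sum_(k : {perm 'I_N})
    tabloid_vec (perm_tabloid k (tabloid T0)) *~ ((-1) ^+ odd_perm k).
  by rewrite [RHS](partition_big (fun k : {perm 'I_N} => k j0) xpredT).
set S := \sum_k _; have SN : S = - S.
  rewrite {1}/S (reindex_inj (mulgI swap)) -sumrN; apply: eq_bigr => k _.
  rewrite perm_tabloidM tabloid_swap odd_permM odd_tperm ij0 addTb.
  by rewrite signrN mulrNz.
apply/ffunP => t; rewrite ffunE.
by move/ffunP/(_ t): SN; rewrite ffunE; lra.
Qed.

(** Choose [k] sending [i0] to [i] and [j0] to [j], and evaluate the relation at the tabloid of [k].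
    Only [k] and [swap * k] reach it, with opposite signs, contributing [a j] and [a i]. *)
Lemma signed_polytabloid_free (a : 'I_N -> int) :
  comb f a = 0 -> forall i j, a i = a j.
Proof.
move=> fa0 i j; have [->//|ij] := eqVneq i j.
have [k [ki kj]] := perm_two ij0 ij.
pose t := perm_tabloid k (tabloid T0).
have MzE (v : tabloid_space N sh) (c : int) : (v *~ c) t = v t *~ c.
  by case: c => m; rewrite /intmul ?ffunE ffunMnE.
pose F (h : {perm 'I_N}) : rat :=
  (t == perm_tabloid h (tabloid T0))%:R *~ ((-1) ^+ odd_perm h) *~ a (h j0).
have fF : comb f a t = \sum_h F h.
  rewrite /comb sum_ffunE.
  rewrite (partition_big (fun h : {perm 'I_N} => h j0) xpredT)//=.
  apply: eq_bigr => l _; rewrite MzE /f sum_ffunE mulrz_suml.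
  by apply: eq_bigr => h /eqP hl; rewrite MzE ffunE /F hl.
have sk : (swap * k)%g != k.
  apply/eqP => /permP/(_ i0); rewrite permM tpermL => /perm_inj/esym/eqP.
  by rewrite (negPf ij0).
move: fF; rewrite fa0 ffunE (bigD1 k)//= (bigD1 (swap * k)%g)//=.
rewrite big1; last first.
  move=> h /andP[hk hsk]; rewrite /F; case: eqP => [/tabloid_inj|_].
    by move=> [e|e]; [rewrite e eqxx in hk|rewrite e eqxx in hsk].
  by rewrite !mul0rz.
rewrite addr0 /F perm_tabloidM tabloid_swap eqxx odd_permM odd_tperm ij0 addTb.
rewrite permM tpermR ki kj signrN mulrNz mulNrz -!mulrzA -mulrzBr -mulrBr.
move=> /esym/eqP; rewrite intr_eq0 mulf_eq0 signr_eq0 /= subr_eq0 => /eqP.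
by move=> ->.
Qed.

Lemma hook_col1 (c : cell sh) : col_of c != 0%N -> c = c1.
Proof. by case/hook_col_neq0 => r c'1; apply: cell_eq; rewrite ?r ?c'1. Qed.

(** The second column is the single cell [c1], so preserving the columns amounts to fixing the entry
    there. *)
Lemma mem_col_stab T g : tableau T ->
  (g \in col_stab T) = (g (T c1) == T c1).
Proof.
move=> /tableauP[injT surT]; rewrite inE; apply/forallP/eqP => [gT|gT c].
  have [c' c'E] := surT (g (T c1)).
  have /forallP/(_ c')/implyP := gT c1; rewrite c'E eqxx col1 => /(_ isT) /eqP.
  by move=> c'1; rewrite -c'E [c']hook_col1// -c'1.
apply/forallP => c'; apply/implyP => /eqP gc.
have [e|/hook_col1 e] := eqVneq (col_of (c' : cell sh)) 0%N.
  have [->|/hook_col1 e'] := eqVneq (col_of (c : cell sh)) 0%N.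
    by rewrite e.
  by move: gc e; rewrite e' gT => /injT <-; rewrite col1.
by move: gc; rewrite e -gT => /perm_inj/injT ->.
Qed.

(** As [g] runs over the column stabilizer of the permuted tableau, [h * g] runs over the
    permutations sending [j0] to [h j0]; the sign of [h] is left over. *)
Lemma polytabloid_perm h :
  polytabloid (perm_filling h T0) = f (h j0) *~ ((-1) ^+ odd_perm h).
Proof.
rewrite /polytabloid /f mulrz_suml [RHS](reindex_inj (mulgI h)) /=.
apply: eq_big => g.
  by rewrite mem_col_stab ?perm_tableau// ffunE permM.
move=> _; rewrite tabloid_perm -perm_tabloidM odd_permM addbC mulrz_signD.
by rewrite -[RHS]mulrzA -expr2 sqrr_sign mulr1z.
Qed.

(** Every polytabloid is some [f j] up to sign. Conversely, the standard tableaux [hook_tableau j]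
    yield [f j] for nonzero [j], and the relation among the [f j] eliminates [f ord0]. *)
Lemma specht_hookE : @specht_lattice N sh = lattice_of f.
Proof.
have fM j (c : int) : lattice_of f (f j *~ c).
  by exists (fun l => (l == j)%:R * c); rewrite comb_delta.
have S0 : @specht_lattice N sh 0.
  by exists (fun=> 0); rewrite big1 // => T _; rewrite mulr0z.
have SD v w : @specht_lattice N sh v -> @specht_lattice N sh w ->
    @specht_lattice N sh (v + w).
  move=> [a ->] [b ->]; exists (fun T => a T + b T).
  by rewrite -big_split; apply: eq_bigr => T _; rewrite mulrzDr.
apply/seteqP; split=> v [a ->].
  apply: (big_ind (lattice_of f)).
  - by exists (fun=> 0); rewrite comb0.
  - by move=> _ _ [b ->] [c ->]; rewrite combD; eexists.
  - move=> T /andP[/(tableau_perm tT0)[h ->] _].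
    by rewrite polytabloid_perm -mulrzA.
have sf j (c : int) : j != ord0 -> @specht_lattice N sh (f j *~ c).
  move=> jn0; pose T := hook_tableau j.
  have [h hT] := tableau_perm tT0 (hook_tableau_is_tableau j).
  have hj : h (T0 c1) = j.
    by move/ffunP/(_ c1): hT; rewrite !ffunE col1.
  exists (fun T' => (T' == T)%:R * (c * (-1) ^+ odd_perm h)).
  rewrite (bigD1 T)//= ?hook_tableau_standard// eqxx mul1r big1 ?addr0.
    rewrite /T hT polytabloid_perm hj -mulrzA mulrC -mulrA -expr2.
    by rewrite sqrr_sign mulr1.
  by move=> T' /andP[_ /negPf ->]; rewrite mul0r mulr0z.
have -> : comb f a = \sum_(j | j != ord0) f j *~ (a j - a ord0).
  transitivity (\sum_j f j *~ (a j - a ord0)).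
    under [RHS]eq_bigr do rewrite mulrzBr.
    by rewrite sumrB -mulrz_suml sum_signed_polytabloid mul0rz subr0.
  by rewrite (bigD1 ord0)//= subrr mulr0z add0r.
by apply: (big_ind (@specht_lattice N sh)) => // j; exact: sf.
Qed.

End Base.

(** The classification of sublattices sees the Specht lattice only through these four properties. *)
Lemma specht_hook_generators : exists f : 'I_N -> tabloid_space N sh,
  [/\ forall g j, perm_act g (f j) = f (g j) *~ ((-1) ^+ odd_perm g),
      \sum_j f j = 0,
      forall a : 'I_N -> int, comb f a = 0 -> forall i j, a i = a j
    & @specht_lattice N sh = lattice_of f].
Proof.
have [||c0 [r0 c00]] := @cell_at 0 0 => //; first exact: ltnW.
have [||c1 [r1 c11]] := @cell_at 0 1 => //; first exact: ltnW.
have tT := hook_tableau_is_tableau ord0.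
exists (signed_polytabloid (hook_tableau ord0) c1); split.
- exact: perm_act_signed_polytabloid.
- exact: (sum_signed_polytabloid tT r0 c00 r1 c11).
- exact: (signed_polytabloid_free tT r0 c00 r1 c11).
- exact: (specht_hookE tT r0 c00 r1 c11).
Qed.
End Hook.

(** * Sums over divisors *)

Section DivisorSum.
Variables (K : comPzRingType) (g : nat -> K).
Hypothesis g1 : g 1%N = 1.
Hypothesis gM : forall a b, (0 < a)%N -> (0 < b)%N -> g (a * b)%N = g a * g b.

(** A divisor is uniquely p^i d with i its p-adic valuation and d dividing m, so a divisor sum
    becomes a double sum. *)
Lemma divisorsM_prime p e m : prime p -> (0 < m)%N -> ~~ (p %| m)%N ->
  perm_eq (divisors (p ^ e * m))
    [seq (p ^ q.1 * q.2)%N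
      | q <- [seq (i, d) | i <- iota 0 e.+1, d <- divisors m]].
Proof.
move=> pp m0 pm; have p0 := prime_gt0 pp.
have cop i d : (d %| m)%N -> coprime (p ^ i) d.
  move=> dm; apply: coprimeXl; rewrite prime_coprime//; apply: contra pm => pd.
  exact: dvdn_trans dm.
have pem : (0 < p ^ e * m)%N by rewrite muln_gt0 expn_gt0 p0.
apply: uniq_perm; first exact: divisors_uniq.
  rewrite map_inj_in_uniq.
    by apply: allpairs_uniq => [||[i d] [j d'] _ _ [-> ->]//];
       rewrite ?iota_uniq ?divisors_uniq.
  have logE k c : c \in divisors m -> logn p (p ^ k * c) = k.
    rewrite -dvdn_divisors// => cm; have c0 := dvdn_gt0 m0 cm.
    rewrite lognM ?expn_gt0 ?p0// pfactorK//.
    rewrite (@logn_coprime p c) ?addn0//.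
    by have := cop 1%N _ cm; rewrite expn1.
  move=> x y /allpairsPdep[i [d [_ dm ->]]].
  move=> /allpairsPdep[j [d' [_ d'm ->]]] /= e0.
  have ij : i = j by rewrite -(logE i d)// e0 logE.
  move: e0; rewrite ij => /eqP.
  by rewrite eqn_pmul2l ?expn_gt0 ?p0// => /eqP ->.
move=> x; rewrite -dvdn_divisors//; apply/idP/mapP.
  move=> xd; have x0 := dvdn_gt0 pem xd.
  have [y cy xE] := pfactor_coprime pp x0.
  exists (logn p x, y); last by rewrite [LHS]xE mulnC.
  apply/allpairsPdep; exists (logn p x), y; split=> //.
    rewrite mem_iota /= add0n ltnS.
    have := dvdn_leq_log p pem xd.
    rewrite lognM ?expn_gt0 ?p0// pfactorK// (@logn_coprime p m) ?addn0//.
    by rewrite prime_coprime.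
  rewrite -dvdn_divisors// -(@Gauss_dvdr _ (p ^ e)%N).
    by apply: dvdn_trans xd; rewrite [X in (_ %| X)%N]xE dvdn_mulr.
  by rewrite coprime_sym coprimeXl.
move=> [_ /allpairsPdep[i [d [+ + ->]]] ->] /=.
rewrite mem_iota /= add0n ltnS -dvdn_divisors// => ie dm.
by rewrite dvdn_mul// dvdn_exp2l.
Qed.

Lemma sum_divisors m : (0 < m)%N ->
  \sum_(d <- divisors m) g d =
  \prod_(p <- primes m) \sum_(i < (logn p m).+1) g p ^+ i.
Proof.
move=> m0.
have gX p i : (0 < p)%N -> g (p ^ i)%N = g p ^+ i.
  move=> p0; elim: i => [|i IH]; rewrite ?expn0 ?expr0// expnS exprS gM ?IH//.
  by rewrite expn_gt0 p0.
(* The exponents are frozen as a function, so that the induction can run over any duplicate-free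
   list of primes. *)
pose e p := logn p m.
have mE : m = (\prod_(p <- primes m) p ^ e p)%N.
  by rewrite [LHS]prod_prime_decomp// prime_decompE big_map.
rewrite [in LHS]mE.
have : all prime (primes m) by apply/allP => p; rewrite mem_primes => /and3P[].
have := primes_uniq m; move: (primes m) => ps; rewrite -/e.
elim: ps => [|p ps IH] /=.
  by rewrite !big_nil (_ : divisors 1 = [:: 1%N])// big_seq1.
move=> /andP[pps ups] /andP[pp aps]; have p0 := prime_gt0 pp.
have M0 : (0 < \prod_(q <- ps) q ^ e q)%N.
  rewrite big_seq; elim/big_ind: _ => // [x y x0 y0|q /(allP aps)/prime_gt0 q0].
    by rewrite muln_gt0 x0.
  by rewrite expn_gt0 q0.
have Mp : ~~ (p %| \prod_(q <- ps) q ^ e q)%N.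
  rewrite big_seq; elim/big_ind: _ => [|x y px py|q qps].
  - by rewrite Euclid_dvd1.
  - by rewrite Euclid_dvdM// negb_or px.
  - rewrite Euclid_dvdX// negb_and dvdn_prime2 ?(allP aps q)//.
    by apply/orP; left; apply: contraNneq pps => ->.
rewrite !big_cons (perm_big _ (divisorsM_prime (e p) pp M0 Mp)).
rewrite big_map big_allpairs -IH// mulr_suml.
have -> : iota 0 (e p).+1 = index_iota 0 (e p).+1 by rewrite /index_iota subn0.
rewrite big_mkord; apply: eq_bigr => i _; rewrite mulr_sumr /=.
rewrite big_seq [RHS]big_seq; apply: eq_bigr => d.
rewrite -dvdn_divisors// => /(dvdn_gt0 M0) d0.
by rewrite gM ?gX// expn_gt0 p0.
Qed.
End DivisorSum.

(** * Convergence *)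

Section Cpow.
Local Open Scope complex_scope.
Variable R : realType.
Implicit Types z w s : R[i].

Lemma cexpD z w : cexp (z + w) = cexp z * cexp w.
Proof.
case: z w => [a b] [c d]; rewrite /cexp /= expRD cosD sinD.
by apply/eqP; rewrite eq_complex /=; apply/andP; split; apply/eqP; ring.
Qed.

Lemma cexp0 : cexp (0 : R[i]) = 1.
Proof. by rewrite /cexp /= expR0 cos0 sin0 mul1r. Qed.

Lemma cexpMn (k : nat) z : cexp (k%:R * z) = cexp z ^+ k.
Proof.
elim: k => [|k IH]; first by rewrite mul0r cexp0.
by rewrite -natr1 mulrDl mul1r cexpD IH exprSr.
Qed.

Lemma norm_cexp z : `|cexp z| = (expR (complex.Re z))%:C.
Proof.
rewrite /cexp normrM normc_def /= expr0n addr0 sqrtr_sqr ger0_norm ?expR_ge0//.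
by rewrite normc_def /= cos2Dsin2 sqrtr1 mulr1.
Qed.

Lemma nat_cpow1 z : nat_cpow 1 z = 1.
Proof. by rewrite /nat_cpow ln1 mulr0 cexp0. Qed.

Lemma nat_cpowM (a b : nat) z : (0 < a)%N -> (0 < b)%N ->
  nat_cpow (a * b) z = nat_cpow a z * nat_cpow b z.
Proof.
move=> a0 b0; rewrite /nat_cpow natrM lnM ?posrE ?ltr0n//.
by rewrite rmorphD mulrDr cexpD.
Qed.

Lemma nat_cpowX (a k : nat) z : (0 < a)%N ->
  nat_cpow (a ^ k) z = nat_cpow a (k%:R * z).
Proof.
move=> a0; rewrite /nat_cpow -mulrA cexpMn.
elim: k => [|k IH]; first by rewrite expn0 ln1 mulr0 cexp0.
rewrite expnS exprS -IH natrM lnM ?posrE ?ltr0n ?expn_gt0 ?a0//.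
by rewrite rmorphD mulrDr cexpD.
Qed.

(** The modulus is (m+1)^(-n Re s), and n Re s is at least 2. *)
Lemma norm_nat_cpow_le (n m : nat) s : (2 <= n)%N -> 1 < complex.Re s ->
  `|nat_cpow m.+1 (- (n%:R * s))| <= (m.+1%:R ^+ 2)^-1.
Proof.
move=> n2 s1; rewrite /nat_cpow norm_cexp.
have -> : complex.Re (- (n%:R * s) * (ln m.+1%:R)%:C) =
    - (n%:R * complex.Re s * ln m.+1%:R) :> R.
  have -> : n%:R = (n%:R : R)%:C by rewrite rmorph_nat.
  by case: (s) => a b /=; ring.
have -> : (m.+1%:R ^+ 2)^-1 = ((expR (2%:R * ln m.+1%:R))^-1 : R)%:C.
  by rewrite expRM_natl lnK ?posrE ?ltr0n// fmorphV rmorphXn /= rmorph_nat.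
rewrite lecR expRN lef_pV2 ?posrE ?expR_gt0// ler_expR.
rewrite ler_wpM2r ?ln_ge0 ?ler1n//.
have : 2 <= n%:R :> R by rewrite ler_nat.
by move=> n2'; nra.
Qed.

Lemma phi_horner (p m : nat) (x : R[i]) :
  (phi R p m).[x] = \sum_(i < (logn p m).+1) x ^+ i.
Proof.
rewrite /phi subrX1 mulKp ?horner_sum.
  by apply: eq_bigr => i _; rewrite hornerXn.
by rewrite -polyC1 polyXsubC_eq0.
Qed.

(** Telescoping: 1/x - 1/(x+1) exceeds 1/(x+1)^2 by 1/(x (x+1)^2). The induction proves the stronger
    bound with 1/M added on the left. The general field covers both [R] and [R[i]]. *)
Lemma tail_inv_sq (F : numFieldType) (K M : nat) : (0 < K <= M)%N ->
  \sum_(K <= k < M) (k.+1%:R ^+ 2)^-1 <= K%:R^-1 :> F.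
Proof.
move=> /andP[K0 KM]; rewrite -subr_ge0; apply: (@le_trans _ _ (M%:R^-1)).
  by rewrite invr_ge0 ler0n.
rewrite lerBrDr -(subnKC KM); elim: (M - K)%N => [|d IH].
  by rewrite addn0 big_geq// addr0.
rewrite addnS big_nat_recr ?leq_addr//=.
apply: le_trans IH; rewrite [X in _ + X]addrC addrA lerD2r addrC.
have x0 : 0 < (K + d)%:R :> F by rewrite ltr0n addn_gt0 K0.
have x1 : 0 < (K + d).+1%:R :> F by rewrite ltr0n.
rewrite -subr_ge0.
have -> : (K + d)%:R^-1 - ((K + d).+1%:R ^- 2 + (K + d).+1%:R^-1) =
    ((K + d)%:R * (K + d).+1%:R ^+ 2)^-1 :> F.
  move: x0 x1; rewrite -natr1; move: ((K + d)%:R : F) => x x0 x1.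
  by field; rewrite !lt0r_neq0.
by rewrite invr_ge0 mulr_ge0 ?exprn_ge0 ?ltW.
Qed.
End Cpow.

(** * Unconditional summation over pairs (k, d) *)

Section Convergence.
Local Open Scope complex_scope.
Local Open Scope classical_set_scope.
Variable R : realType.

Lemma is_cvg_series_inv_sq (u : nat -> R) :
  (forall k, `|u k| <= (k.+1%:R ^+ 2)^-1) -> cvgn (series u).
Proof.
move=> uB; apply: normed_cvg.
apply: (@series_le_cvg R _ (fun k => (k.+1%:R ^+ 2)^-1)) => [k|k|//|].
- exact: normr_ge0.
- by rewrite invr_ge0 exprn_ge0.
apply: nondecreasing_is_cvgn.
  by apply: nondecreasing_series => k _ _; rewrite invr_ge0 exprn_ge0.
(* The first term is 1, and the tail estimate from K = 1 bounds the rest by 1. *)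
exists (1 + 1) => _ [[|M] _ <-]; rewrite /series /=; first by rewrite big_geq.
rewrite big_nat_recl// expr1n invr1 lerD2l.
have [->|M0] := posnP M; first by rewrite big_geq.
by have := @tail_inv_sq R 1 M.+1 isT; rewrite big_add1 /= invr1.
Qed.

Lemma normc_ge_Im (x : R[i]) : `|complex.Im x|%:C <= `|x|.
Proof.
case: x => a b; rewrite normc_def lecR -sqrtr_sqr ler_wsqrtr//=.
by rewrite lerDr sqr_ge0.
Qed.

(** Real and imaginary parts are dominated by the modulus, so both real series converge; their
    limits are the coordinates of the complex limit. *)
Lemma is_cvg_complex_series_inv_sq (z : nat -> R[i]) :
  (forall k, `|z k| <= (k.+1%:R ^+ 2)^-1) ->
  cvgn (series (fun k => z k : R[i]^o)).
Proof.
move=> zB.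
have bE k : (k.+1%:R ^+ 2)^-1 = ((k.+1%:R ^+ 2)^-1 : R)%:C.
  by rewrite fmorphV rmorphXn /= rmorph_nat.
have /cvg_ex[a /cvgrPdist_lt ca] : cvgn (series (fun k => complex.Re (z k))).
  apply: is_cvg_series_inv_sq => k; rewrite -lecR -bE.
  exact: le_trans (normc_ge_Re _) (zB k).
have /cvg_ex[b /cvgrPdist_lt cb] : cvgn (series (fun k => complex.Im (z k))).
  apply: is_cvg_series_inv_sq => k; rewrite -lecR -bE.
  exact: le_trans (normc_ge_Im _) (zB k).
apply/cvg_ex; exists (a +i* b); apply/cvgrPdist_lt => e e0.
have eR : e = (complex.Re e)%:C by rewrite RRe_real// gtr0_real.
have e20 : 0 < complex.Re e / 2 by rewrite divr_gt0// -ltcR -eR.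
near=> M.
have serE : series (fun k => z k : R[i]^o) M =
    (series (fun k => complex.Re (z k)) M) +i*
    (series (fun k => complex.Im (z k)) M).
  rewrite /series /=; elim: (M) => [|m IH]; first by rewrite !big_geq.
  by rewrite !big_nat_recr//= IH; case: (z m).
rewrite serE.
pose x := a - series (fun k => complex.Re (z k)) M.
pose y := b - series (fun k => complex.Im (z k)) M.
have -> : a +i* b - (series (fun k => complex.Re (z k)) M +i*
    series (fun k => complex.Im (z k)) M) = x%:C + 'i * y%:C.
  apply/eqP; rewrite eq_complex /=.
  by rewrite !(mul0r, mul1r, subr0, addr0, add0r, mulr0) !eqxx.
apply: le_lt_trans (ler_normD _ _) _.
rewrite normrM !normc_def /= !expr0n !expr1n !addr0 add0r sqrtr1 mul1r.
rewrite !sqrtr_sqr -rmorphD /= eR ltcR [ltRHS]splitr ltrD//.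
  by rewrite /x; near: M; exact: ca.
by rewrite /y; near: M; exact: cb.
Unshelve. all: by end_near. Qed.

Lemma sum_uniq_sub (T : eqType) (V : nmodType) (s r : seq T) (F : T -> V) :
  uniq s -> uniq r -> {subset s <= r} ->
  \sum_(x <- r | x \in s) F x = \sum_(x <- s) F x.
Proof.
move=> us ur sr; rewrite -big_filter; apply: perm_big.
apply: uniq_perm => // [|x]; first exact: filter_uniq.
by rewrite mem_filter andb_idr// => /sr.
Qed.

(** The map [p] identifies [I] with the pairs (k, d), d in [ds]. A finite sum containing the
    rectangle k < K is a partial sum of the series times the sum of [w], plus terms with k >= K,
    whose total modulus is at most W'/K. *)
Lemma totally_prod_cvg (I : choiceType) (ds : seq nat) (p : I -> nat * nat)
    (z w : nat -> R[i]) :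
  uniq ds -> injective p -> (forall i, (p i).2 \in ds) ->
  (forall k d, d \in ds -> exists i, p i = (k, d)) ->
  (forall k, `|z k| <= (k.+1%:R ^+ 2)^-1) ->
  partial_sum (fun i => z (p i).1 * w (p i).2 : R[i]^o) @ totally -->
  (limn (series (fun k => z k : R[i]^o)) * \sum_(d <- ds) w d : R[i]^o).
Proof.
have totF := @totally_filter I.
move=> uds pI pds pS zB; apply/cvgrPdist_lt => e e0.
set Z := limn _; set W := \sum_(d <- ds) w d.
pose W' := \sum_(d <- ds) `|w d|.
have W'0 : 0 <= W' by rewrite sumr_ge0.
have WW' : `|W| <= W' by exact: ler_norm_sum.
have eR : e = (complex.Re e)%:C by rewrite RRe_real// gtr0_real.
have WR : W' = (complex.Re W')%:C by rewrite RRe_real// ger0_real.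
have V0 : 0 < W' + 1 by rewrite ltr_wpDl.
(* Thus [e1 * (W' + 1)] is half of [e]; the added 1 keeps the denominator positive when [W']
   vanishes. *)
pose e1 : R[i] := e / (W' + 1) / 2.
have e10 : 0 < e1 by rewrite !divr_gt0.
have e1R : e1 = (complex.Re e1)%:C by rewrite RRe_real// gtr0_real.
have /cvgrPdist_lt/(_ _ e10) := is_cvg_complex_series_inv_sq zB.
rewrite -/Z => -[K1 _ K1P].
have [K2 K2P] : exists K : nat, (0 < K)%N /\ K%:R^-1 < e1.
  exists (Num.truncn (complex.Re e1)^-1).+1; split=> //.
  have r0 : 0 < complex.Re e1 by rewrite -ltcR -e1R.
  have -> : (Num.truncn (complex.Re e1)^-1).+1%:R^-1 =
      ((Num.truncn (complex.Re e1)^-1).+1%:R^-1 : R)%:C.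
    by rewrite fmorphV /= rmorph_nat.
  rewrite e1R ltcR invf_plt ?posrE ?ltr0n//.
  by rewrite truncnS_gt.
move: K2P => [K20 K2e].
(* [K1] controls the partial sum on the rectangle, [K2] the terms outside it. *)
pose K := maxn K1 K2.
have K0 : (0 < K)%N by rewrite leq_max K20 orbT.
have Ke : K%:R^-1 < e1.
  apply: le_lt_trans K2e; rewrite lef_pV2 ?posrE ?ltr0n// ler_nat.
  by rewrite leq_max leqnn orbT.
pose rect a b := [seq (k, d) | k <- index_iota a b, d <- ds].
have urect a b : uniq (rect a b).
  apply: allpairs_uniq => // [|[k d] [k' d'] _ _ [-> ->]//].
  exact: iota_uniq.
(* Finitely many indices cover the rectangle; the estimate is then proved for every finite set
   containing [A0]. *)
have [A0 A0P] : exists A0 : {fset I}, forall q, q \in rect 0%N K ->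
    exists2 i, i \in A0 & p i = q.
  have : forall q, q \in rect 0%N K -> exists i, p i = q.
    by move=> _ /allpairsPdep[k [d [_ dds ->]]]; exact: pS.
  elim: (rect 0%N K) => [|q r IH] rP; first by exists fset0.
  have [i pi] := rP q (mem_head _ _).
  have [|B BP] := IH; first by move=> q' q'r; apply: rP; rewrite inE q'r orbT.
  exists (i |` B)%fset => q'; rewrite inE => /predU1P[->|/BP[i' i'B <-]].
    by exists i; rewrite // fset1U1.
  by exists i'; rewrite // fset1Ur.
exists A0 => // A /= A0A.
rewrite /partial_sum.
rewrite -(big_seq_fsetE _ A predT (fun i => z (p i).1 * w (p i).2)).
pose F (q : nat * nat) := z q.1 * w q.2.
pose s := [seq p i | i <- A].
have us : uniq s by rewrite map_inj_uniq// fset_uniq.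
have -> : \sum_(i <- A) z (p i).1 * w (p i).2 = \sum_(q <- s) F q.
  by rewrite big_map.
have rs : {subset rect 0%N K <= s}.
  move=> q /A0P[i iA0 <-]; apply: map_f; exact: (fsubsetP A0A).
rewrite (bigID (fun q => q \in rect 0%N K))/= sum_uniq_sub//.
have rectE a b (G : nat * nat -> R[i]) : \sum_(q <- rect a b) G q =
    \sum_(a <= k < b) \sum_(d <- ds) G (k, d).
  by rewrite big_allpairs.
rewrite rectE {1}/F /=.
under eq_bigr do rewrite -mulr_sumr.
rewrite -mulr_suml -/W opprD addrA -mulrBl.
apply: le_lt_trans (ler_normB _ _) _.
have e12 : e = e1 * (W' + 1) + e1 * (W' + 1).
  by rewrite /e1; field; rewrite lt0r_neq0.
rewrite e12; apply: ltr_leD.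
  rewrite normrM; apply: (@le_lt_trans _ _ (e1 * `|W|)).
    rewrite ler_wpM2r//; apply/ltW/K1P => /=; exact: leq_maxl.
  by rewrite ltr_pM2l// (le_lt_trans WW')// ltrDl.
(* [M] exceeds every first component in [s], so the remaining pairs lie in the rectangle from [K] to
   [M]. *)
pose M := (K + \max_(q <- s) q.1.+1)%N.
have s'r : {subset [seq q <- s | q \notin rect 0%N K] <= rect K M}.
  move=> q; rewrite mem_filter => /andP[qr qs].
  have [i iA qi] := mapP qs.
  apply/allpairsP; exists q; split; last by case: q {qr qs qi}.
    rewrite mem_index_iota; apply/andP; split.
      rewrite leqNgt; apply: contra qr => qK; apply/allpairsP; exists q.
      by split; [rewrite mem_index_iota|rewrite qi|case: q {qs qi qK}].
    rewrite ltn_addl//.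
    by apply: (@leq_bigmax_seq _ s xpredT (fun q => q.1.+1)).
  by rewrite qi.
apply: le_trans (ler_norm_sum _ _ _) _.
rewrite -big_filter -(sum_uniq_sub _ _ (urect K M) s'r) ?filter_uniq//.
apply: (@le_trans _ _ (\sum_(q <- rect K M) `|F q|)).
  by rewrite big_mkcond; apply: ler_sum => q _; case: ifP.
rewrite rectE.
apply: (@le_trans _ _ (K%:R^-1 * W')).
  apply: (@le_trans _ _ ((\sum_(K <= k < M) (k.+1%:R ^+ 2)^-1) * W')).
    rewrite mulr_suml; apply: ler_sum => k _.
    under eq_bigr do rewrite /F normrM /=.
    by rewrite -mulr_sumr ler_wpM2r.
  by rewrite ler_wpM2r// tail_inv_sq// K0 leq_addr.
by apply: ler_pM; rewrite ?invr_ge0 ?ler0n// ?ltW// ltrDl.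
Qed.

End Convergence.

(** * The zeta function of the Specht lattice *)

Theorem corollary2 (R : realType) (n : nat) (hn : (2 <= n)%N) :
  exists sigma0 : R, forall s : R[i], sigma0 < complex.Re s ->
    let L := @specht_lattice n.+1 (hook_shape n) in
    let act := @perm_act n.+1 (hook_shape n) in
    solomon_cvg act L s /\
    solomon_zeta act L s =
      riemann_zeta (n%:R * s) *
      \prod_(p <- primes n.+1) (phi R p n.+1).[nat_cpow p (- s)].
Proof.
(* With Re s > 1 and n >= 2 the series in m is dominated by inverse squares. *)
exists 1 => s s1 L act.
have [f [act_f sum_f f_free LE]] := specht_hook_generators hn.
rewrite -/L in LE.
have actB := @perm_actB n.+1 (hook_shape n).
(* A sublattice with parameters (m, d) is encoded as (m - 1, d), so that the first component ranges
   over all of [nat]. *)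
have /choice[p pP] : forall i : finite_index_sublattices act L,
    exists q : nat * nat, (q.2 %| n.+1)%N /\
      val i = scaled_sublattice f q.1.+1 q.2.
  move=> [K /= /set_mem [subK finK]]; rewrite LE in subK finK.
  have [m [d [m0 _ dN ->]]] :=
    sublattice_classification hn actB act_f sum_f subK finK.
  by exists (m.-1, d); rewrite /= prednK.
have indexE m d (dN : (d %| n.+1)%N) :=
  scaled_sublattice_index hn actB act_f sum_f f_free (ltn0Sn m)
    (dvdn_gt0 (ltn0Sn n) dN) dN.
have pI : injective p.
  move=> i j pij; apply: val_inj.
  by rewrite (pP i).2 (pP j).2 pij.
(* As [p] comes from a choice, uniqueness of the parameters is needed to see that it returns this
   very pair. *)
have pS k d : d \in divisors n.+1 -> exists i, p i = (k, d).
  rewrite -dvdn_divisors// => dN.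
  have mem : scaled_sublattice f k.+1 d \in finite_index_sublattices act L.
    apply/mem_set; split; rewrite LE; last exact: (indexE k d dN).1.
    exact: (scaled_sublatticeP actB act_f sum_f).
  exists (SigSub mem); have [dN' /= vE] := pP (SigSub mem).
  have [] := scaled_sublattice_inj hn actB act_f sum_f f_free
    _ _ _ _ dN dN' vE => //.
  - exact: dvdn_gt0 dN.
  - exact: dvdn_gt0 dN'.
  - by move=> ek ed; rewrite [LHS]surjective_pairing -ed; congr pair; case: ek.
pose z k := nat_cpow k.+1 (- (n%:R * s)); pose w d := nat_cpow d (- s).
(* The index m^n d splits each term into m^(-ns), summing to the Riemann zeta value, and d^(-s),
   summing over the divisors of n+1. *)
have termE : @solomon_term R _ _ act L s =
    (fun i => z (p i).1 * w (p i).2 : R[i]^o).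
  apply/funext => i; have [dN vE] := pP i.
  rewrite /solomon_term vE {1}LE (indexE _ _ dN).2.
  rewrite nat_cpowM ?expn_gt0//; last exact: dvdn_gt0 dN.
  by rewrite nat_cpowX// mulrN.
have cvgT : (partial_sum (@solomon_term R _ _ act L s) @ totally -->
    (riemann_zeta (n%:R * s) * \sum_(d <- divisors n.+1) w d : R[i]^o))%classic.
  rewrite termE; apply: totally_prod_cvg (divisors_uniq _) pI _ pS _ => [i|k].
    by rewrite -dvdn_divisors// (pP i).1.
  exact: norm_nat_cpow_le.
have totF := @totally_filter (finite_index_sublattices act L).
split; first by apply/cvg_ex; eexists; exact: cvgT.
rewrite /solomon_zeta /summability.sum (cvg_lim _ cvgT)//.
rewrite (@sum_divisors _ w (nat_cpow1 _) (fun a b => @nat_cpowM R a b (- s)))//.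
by congr (_ * _); apply: eq_bigr => q _; rewrite phi_horner.
Qed.
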